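(* Suppose that the level set $\mathcal{X}:=\{x\in\mathrm{dom}(F):F(x)\leq F(x^0)\}$ is compact, and let $\{(x^k,y^k,z^k,c_k):k\in\mathbb{N}\}$ be generated by the algorithm AMPDA. Then the following statements hold. (i) The sequence $\{(x^k,y^k,z^k,c_k):k\in\mathbb{N}\}$ is bounded. (ii) The sequence $\{F(x^k):k\in\mathbb{N}\}$ descends monotonically with $F_{\infty}:=\inf\{F(x^k):k\in\mathbb{N}\}=\lim_{k\to\infty}F(x^k)$, and $\lim_{k\to\infty}\|x^{k+1}-x^k\|_2=0$. (iii) Given $\epsilon>0$, there exists $\hat{k}\leq K$ with $$K:=\frac{2(F(x^0)-F_{\infty})}{\sigma\epsilon^2},$$ such that $x^{\hat{k}}$ is an $\epsilon$-critical point of $F$.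
   Context: Setting: $f,g:\mathbb{R}^n\to[0,+\infty)$ and $h:\mathbb{R}^n\to\mathbb{R}$ are proper closed (lower semicontinuous), $\mathcal{C}\subseteq\mathbb{R}^n$ is closed, $\Omega:=\{x\in\mathbb{R}^n: g(x)\neq 0\}$, and $\mathcal{C}\cap\Omega\neq\emptyset$. Standing assumptions: (i) $f$ is locally Lipschitz continuous on $\Omega$; (ii) $g$ is convex on $\mathbb{R}^n$; (iii) $h=h_1-h_2$, where $h_1:\mathbb{R}^n\to\mathbb{R}$ is locally Lipschitz differentiable around each $x\in\Omega$ (each $x\in\Omega$ has a ball on which $h_1$ is continuously differentiable with Lipschitz gradient) and $h_2:\mathbb{R}^n\to\mathbb{R}$ is convex; (iv) the proximal operator of $f_{\mathcal{C}}$ can be evaluated, where $f_{\mathcal{C}}:=f+\iota_{\mathcal{C}}$ and $\iota_{\mathcal{C}}$ is $0$ on $\mathcal{C}$, $+\infty$ elsewhere. Notation: $\mathbb{N}$ is the set of nonnegative integers. $F(x)=f(x)/g(x)+h(x)$ if $x\in\Omega\cap\mathcal{C}$, $F(x)=+\infty$ otherwise. $\mathrm{prox}_{\varphi}(x):=\arg\min\{\varphi(z)+\frac12\|x-z\|_2^2:z\in\mathbb{R}^n\}$ (a set). $\partial g,\partial h_2$ are convex subdifferentials; $g^*,h_2^*$ are convex conjugates. The function $Q:\mathbb{R}^n\times\mathbb{R}^n\times\mathbb{R}^n\times\mathbb{R}\to(-\infty,+\infty]$ is $$Q(x,y,z,c)=\iota_{\mathcal{C}}(x)+2cf(x)+c^2f(x)(g^*(y)-\langle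 x,y\rangle)+h_1(x)+h_2^*(z)-\langle x,z\rangle$$ if $(y,z)\in\mathrm{dom}(g^* )\times\mathrm{dom}(h_2^* )$, and $+\infty$ otherwise. Algorithm AMPDA. Step 0: input $x^0\in\mathrm{dom}(F)$, $0<\underline{\alpha}\leq\overline{\alpha}$, $\sigma>0$, $0<\gamma<1$; set $k=0$. Step 1: compute $c_k=1/g(x^k)$; choose any $(y^k,z^k)\in\partial g(x^k)\times\partial h_2(x^k)$; set $\alpha:=\widetilde{\alpha}_k$ for some $\widetilde{\alpha}_k\in[\underline{\alpha},\overline{\alpha}]$. Step 2: compute any $$\widehat{x}^k\in\mathrm{prox}_{\alpha c_kf_{\mathcal{C}}}\big(x^k-\alpha(\nabla h_1(x^k)-z^k-c_k^2f(x^k)y^k)\big).$$ If $\widehat{x}^k\in\Omega$ and $Q(\widehat{x}^k,y^k,z^k,1/g(\widehat{x}^k))+\frac{\sigma}{2}\|\widehat{x}^k-x^k\|_2^2\leq F(x^k)$, then set $x^{k+1}=\widehat{x}^k$ and go to Step 3; else set $\alpha:=\alpha\gamma$ and repeat Step 2. Step 3: record $\alpha_k:=\alpha$, set $k\leftarrow k+1$, and go to Step 1. $\epsilon$-critical point: for $\epsilon\geq0$, $\bar{x}\in\Omega$ is an $\epsilon$-critical point of $F$ if there exist $\alpha>0$ and $(\bar{y},\bar{z})\in\partial g(\bar{x})\times\partial h_2(\bar{x})$ such that, with $\bar{c}=1/g(\bar{x})$, $$\mathrm{dist}\Big(\bar{x},\ \mathrm{prox}_{\alpha\bar{c}f_{\mathcal{C}}}\big(\bar{x}-\alpha(\nabla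 h_1(\bar{x})-\bar{z}-\bar{c}^2f(\bar{x})\bar{y})\big)\Big)\leq\epsilon,$$ where $\mathrm{dist}(x,\mathcal{A})=\inf\{\|x-y\|_2:y\in\mathcal{A}\}$. *)

(* Defs.v *)
From HB Require Import structures.
From mathcomp Require Import all_boot all_order all_algebra.
From mathcomp Require Import all_classical all_reals all_analysis.

Set Implicit Arguments.
Unset Strict Implicit.
Unset Printing Implicit Defensive.

Import Order.TTheory GRing.Theory Num.Theory.
Import numFieldNormedType.Exports.

Local Open Scope classical_set_scope.
Local Open Scope ring_scope.

Section euclidean.
Context {R : realType} {n : nat}.
Implicit Types (x y z : 'rV[R]_n) (A C : set 'rV[R]_n).

Definition dotp x y : R := \sum_i x 0 i * y 0 i.

(* The library norm `|x| on 'rV[R]_n is the sup norm; it induces the same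
   topology, bounded sets and Lipschitz functions as the Euclidean norm. *)
Definition l2norm x : R := Num.sqrt (dotp x x).

Definition l2ball x (r : R) : set 'rV[R]_n := [set u | l2norm (u - x) < r].

(* Valued in \bar R because inf of the empty set of reals is 0 in the library,
   whereas the distance to the empty set is +oo. *)
Definition l2dist x A : \bar R :=
  ereal_inf [set (l2norm (x - y))%:E | y in A].

Definition grad (phi : 'rV[R]_n -> R) x : 'rV[R]_n :=
  \row_i 'D_(delta_mx 0 i) phi x.

Definition locally_lipschitz (phi : 'rV[R]_n -> R) A :=
  forall x, A x ->
    exists2 r : R, 0 < r & [lipschitz (phi u : R^o) | u in l2ball x r `&` A].

Definition locally_lipschitz_differentiable (phi : 'rV[R]_n -> R) A :=
  forall x, A x -> exists2 r : R, 0 < r &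
    [/\ forall u, l2ball x r u -> differentiable (phi : _ -> R^o) u,
        {within l2ball x r, continuous (grad phi)} &
        [lipschitz (grad phi u) | u in l2ball x r]].

Definition subdiff (phi : 'rV[R]_n -> R) x : set 'rV[R]_n :=
  [set y | forall w, phi x + dotp y (w - x) <= phi w].

Definition conjugate (phi : 'rV[R]_n -> R) y : \bar R :=
  ereal_sup [set (dotp x y - phi x)%:E | x in setT].

Definition edom (phi : 'rV[R]_n -> \bar R) : set 'rV[R]_n :=
  [set x | (phi x < +oo)%E].

Definition set_iota C x : \bar R := if x \in C then 0%E else +oo%E.

Definition prox (phi : 'rV[R]_n -> \bar R) x : set 'rV[R]_n :=
  [set z | forall w, (phi z + (2^-1 * l2norm (x - z) ^+ 2)%:E
                      <= phi w + (2^-1 * l2norm (x - w) ^+ 2)%:E)%E].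

End euclidean.

Section fractional_program.
Context {R : realType} {n : nat}.
Variables (f g h h1 h2 : 'rV[R]_n -> R) (C : set 'rV[R]_n).
Implicit Types (x y z w : 'rV[R]_n) (a c : R).

Definition Omega : set 'rV[R]_n := [set x | g x != 0].

Definition objective x : \bar R :=
  if x \in Omega `&` C then (f x / g x + h x)%:E else +oo%E.

Definition fC x : \bar R := ((f x)%:E + set_iota C x)%E.

Definition Qfun x y z c : \bar R :=
  if (y \in edom (conjugate g)) && (z \in edom (conjugate h2)) then
    (set_iota C x + (2 * c * f x)%:E
     + (c ^+ 2 * f x)%:E * (conjugate g y - (dotp x y)%:E)
     + (h1 x)%:E + conjugate h2 z - (dotp x z)%:E)%E
  else +oo%E.

Definition prox_step a x y z c : set 'rV[R]_n :=
  prox (fun w => ((a * c)%:E * fC w)%E)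
       (x - a *: (grad h1 x - z - (c ^+ 2 * f x) *: y)).

Definition eps_critical (eps : R) x :=
  Omega x /\
  exists a y z, [/\ 0 < a, subdiff g x y, subdiff h2 x z &
    (l2dist x (prox_step a x y z (g x)^-1) <= eps%:E)%E].

Variables (alow aup sigma gamma : R).

Definition accepted x y z w :=
  Omega w /\
  (Qfun w y z (g w)^-1 + (sigma / 2 * l2norm (w - x) ^+ 2)%:E
   <= objective x)%E.

(* At iteration k the backtracking starts from the step size a0 and performs j
   reductions: each of the first j trial points is some element of the proximal
   set that fails the acceptance test, and the next trial point passes it. *)
Definition AMPDA (x y z : nat -> 'rV[R]_n) (c : nat -> R) :=
  edom objective (x 0%N) /\
  forall k,
    [/\ c k = (g (x k))^-1, subdiff g (x k) (y k), subdiff h2 (x k) (z k) &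
      exists (a0 : R) (j : nat),
        [/\ alow <= a0 <= aup,
            forall i, (i < j)%N ->
              exists2 w, prox_step (a0 * gamma ^+ i) (x k) (y k) (z k) (c k) w
                       & ~ accepted (x k) (y k) (z k) w,
            prox_step (a0 * gamma ^+ j) (x k) (y k) (z k) (c k) (x k.+1) &
            accepted (x k) (y k) (z k) (x k.+1)]].

End fractional_program.

(* Main.v *)
(* By the Fenchel-Young inequalities for g and h2, F (w) <= Q (w, y, z, 1 / g w),
   so every accepted step decreases F by at least sigma / 2 * |w - x|^2 and the
   iterates stay in the compact level set. There g and h, being lower
   semicontinuous, are bounded below (g by a positive constant), which bounds c_k
   and F, while the subgradients y_k and z_k of finite convex functions at a bounded
   set of points are bounded. Telescoping the decrease gives the limits and the
   complexity bound, since x_(k+1) belongs to the proximal set at x_k and hence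
   |x_(k+1) - x_k| bounds the distance from x_k to that set. *)

Require Import Defs.
From HB Require Import structures.
From mathcomp Require Import all_boot all_order all_algebra.
From mathcomp Require Import all_classical all_reals all_analysis.
From mathcomp Require Import ring lra.

Import Order.TTheory GRing.Theory Num.Theory.
Import numFieldNormedType.Exports.

Local Open Scope classical_set_scope.
Local Open Scope ring_scope.

(** * Semicontinuity on compact sets *)

(** Semicontinuity spreads each pointwise bound to a neighbourhood, and compactness makes these
    local bounds uniform. The filter [G] lets one statement yield both positive bounds ([a] tending
    to 0 from the right) and bounds of any sign ([a] tending to -oo). *)
Lemma lower_semicontinuous_near_compact {X : topologicalType} {R : realType}
    (phi : X -> \bar R) (K : set X) (G : set_system R) {FG : Filter G} :
  lower_semicontinuous phi -> compact K ->
  (forall u, K u -> exists2 b, (b%:E < phi u)%E & \forall a \near G, a <= b) ->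
  \forall a \near G, forall u, K u -> (a%:E < phi u)%E.
Proof.
move=> phi_lsc /compact_near_coveringP Kcov Kb.
apply: (Kcov R G (fun a u => (a%:E < phi u)%E)) => u /Kb[b /phi_lsc[V Vu Vb] Gb].
exists (V, [set a | a <= b]) => // -[v a] /= [Vv ab].
by rewrite (le_lt_trans _ (Vb _ Vv)) ?lee_fin.
Qed.

(** * Bounds for finite convex functions and their subgradients *)

Section convex_bounds.
Context {R : realType}.

Lemma convex_function_le {E : lmodType R} {phi : E -> R} (t : R) (u v : E) :
  @convex_function R E setT phi -> 0 <= t <= 1 ->
  phi (t *: u + (1 - t) *: v) <= t * phi u + (1 - t) * phi v.
Proof.
move=> phi_convex /andP[t0 t1].
exact: (phi_convex (Itv01 t0 t1) u v (in_setT _) (in_setT _)).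
Qed.

Context {n : nat}.
Implicit Types (phi : 'rV[R]_n -> R) (u v w : 'rV[R]_n).

Lemma row_normr_le u (B : R) :
  0 <= B -> (forall i, `|u 0 i| <= B) -> `|u| <= B.
Proof.
move=> B0 uB; rewrite [leLHS]mx_normrE; apply: bigmax_le => // -[i j] _ /=.
by rewrite ord1.
Qed.

Lemma normr_row_ge u i : `|u 0 i| <= `|u|.
Proof.
rewrite [leRHS]mx_normrE.
exact: (le_bigmax _ (fun ij : 'I_1 * 'I_n => `|u ij.1 ij.2|) (0, i)).
Qed.

(* On each segment [-M, M] in a coordinate direction a convex function is
   bounded by its values at the two end points. *)
Lemma convex_function_above phi (M : R) :
  @convex_function R 'rV[R]_n setT phi ->
  exists B, forall u, `|u| <= M -> phi u <= B.
Proof.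
move=> phi_convex; wlog M0 : M / 0 < M => [above|].
  have [B phiB] := above (Num.max M 1) ltac:(by rewrite lt_max ltr01 orbT).
  by exists B => u uM; apply: phiB; rewrite le_max uM.
(* Induction on the free coordinates; [v] stays arbitrary because freeing coordinate [i] shifts the
   base point by [M] or [- M] along it. *)
suff box (s : seq 'I_n) v : exists B, forall t : 'I_n -> R,
    (forall i, `|t i| <= M) ->
    phi (v + \sum_(i <- s) t i *: delta_mx 0 i) <= B.
  have [B phiB] := box (index_enum 'I_n) 0.
  exists B => u uM; rewrite [u]row_sum_delta -[X in phi X]add0r; apply: phiB => i.
  exact: le_trans (normr_row_ge u i) uM.
elim: s v => [|i s IHs] v; first by exists (phi v) => t _; rewrite big_nil addr0.
have [B1 phiB1] := IHs (v + M *: delta_mx 0 i).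
have [B2 phiB2] := IHs (v - M *: delta_mx 0 i).
exists (Num.max B1 B2) => t tM; rewrite big_cons.
(* [l] is the weight with [t i = l * M + (1 - l) * (- M)]. *)
set r := \sum_(j <- s) _; pose l := (t i + M) / (2 * M).
have /andP[l0 l1] : 0 <= l <= 1.
  have := tM i; rewrite ler_norml => /andP[tl tr].
  by rewrite /l ler_pdivlMr ?ler_pdivrMr; lra.
have -> : v + (t i *: delta_mx 0 i + r) =
    l *: (v + M *: delta_mx 0 i + r) + (1 - l) *: (v - M *: delta_mx 0 i + r).
  apply/rowP => j; rewrite !mxE /l; field; lra.
apply: le_trans (convex_function_le l _ _ phi_convex _) _; first by rewrite l0.
have b1 : phi (v + M *: delta_mx 0 i + r) <= Num.max B1 B2.
  by rewrite le_max phiB1.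
have b2 : phi (v - M *: delta_mx 0 i + r) <= Num.max B1 B2.
  by rewrite le_max phiB2 ?orbT.
nra.
Qed.

Lemma dotpC u v : dotp u v = dotp v u.
Proof. by apply: eq_bigr => i _; rewrite mulrC. Qed.

Lemma dotpBr u v w : dotp u (v - w) = dotp u v - dotp u w.
Proof. by rewrite -sumrB; apply: eq_bigr => i _; rewrite !mxE mulrBr. Qed.

Lemma dotpZr (a : R) u v : dotp u (a *: v) = a * dotp u v.
Proof. by rewrite mulr_sumr; apply: eq_bigr => i _; rewrite !mxE mulrCA. Qed.

Lemma dotp_delta u i : dotp u (delta_mx 0 i) = u 0 i.
Proof.
rewrite /dotp (bigD1 i) //= big1 => [|j ji].
  by rewrite mxE !eqxx mulr1 addr0.
by rewrite mxE (negbTE ji) andbF mulr0.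
Qed.

Lemma l2normB u v : l2norm (u - v) = l2norm (v - u).
Proof.
by congr Num.sqrt; apply: eq_bigr => i _; rewrite !mxE -mulrNN !opprB.
Qed.

(** The subgradient inequality at [u] plus or minus a unit vector gives [|v 0 i| <= B - phi u],
    where [B] bounds [phi] on the ball of radius [M + 1]; a lower bound on [phi u] then finishes. *)
Lemma subdiff_bounded phi (M : R) :
  @convex_function R 'rV[R]_n setT phi ->
  exists B, forall u v, `|u| <= M -> subdiff phi u v -> `|v| <= B.
Proof.
move=> phi_convex; have [B phiB] := convex_function_above phi (M + 1) phi_convex.
exists (2 * B - 2 * phi 0) => u v uM phiv.
have M0 : 0 <= M by apply: le_trans uM.
have phi0B : phi 0 <= B by apply: phiB; rewrite normr0; lra.
apply: row_normr_le => [|i]; first lra.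
have phiN : phi (- u) <= B by apply: phiB; rewrite normrN; lra.
(* midpoint convexity between u and - u bounds phi u from below *)
have phi_mid : phi 0 <= 2^-1 * phi u + (1 - 2^-1) * phi (- u).
  apply: le_trans (convex_function_le 2^-1 u (- u) phi_convex _); last lra.
  suff -> : 2^-1 *: u + (1 - 2^-1) *: - u = 0 by [].
  by apply/rowP => j; rewrite !mxE; field.
have step (a : R) : `|a| <= 1 -> phi u + a * v 0 i <= B.
  move=> a1; have := phiv (u + a *: delta_mx 0 i).
  rewrite [u + _]addrC addrK dotpZr dotp_delta => /le_trans; apply; apply: phiB.
  apply: le_trans (ler_normD _ _) _; rewrite addrC lerD //.
  apply: row_normr_le => // j; rewrite !mxE eqxx /=.
  by case: (_ == _); rewrite ?mulr1 ?mulr0 ?normr0.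
have := step 1; have := step (-1).
rewrite normrN normr1 lexx => /(_ isT) ? /(_ isT) ?.
by rewrite ler_norml; apply/andP; split; lra.
Qed.

(** Equality case of Fenchel-Young: the supremum is attained at [u]. Hence the conjugates in [Qfun]
    are finite and explicit. *)
Lemma conjugate_subdiff phi u v :
  subdiff phi u v -> conjugate phi v = (dotp u v - phi u)%:E.
Proof.
move=> phiv; apply/eqP; rewrite eq_le; apply/andP; split.
  apply: ge_ereal_sup => _ [w _ <-]; rewrite lee_fin.
  by have := phiv w; rewrite dotpBr (dotpC v) (dotpC v); lra.
by apply: ereal_sup_ubound; exists u.
Qed.

End convex_bounds.

(** * Decrease of the objective at an accepted point *)

Section descent.
Context {R : realType} {n : nat}.
Variables (f g h h1 h2 : 'rV[R]_n -> R) (C : set 'rV[R]_n) (sigma : R).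
Hypothesis f_ge0 : forall u, 0 <= f u.
Hypothesis h_dec : forall u, h u = h1 u - h2 u.
Implicit Types x y z w : 'rV[R]_n.

Lemma edom_objectiveP x : edom (objective f g h C) x -> Omega g x /\ C x.
Proof.
by rewrite /edom /objective /=; case: ifPn => // /set_mem[].
Qed.

Lemma objectiveE x :
  Omega g x -> C x -> objective f g h C x = (f x / g x + h x)%:E.
Proof. by move=> gx Cx; rewrite /objective mem_set. Qed.

Lemma accepted_descent x y z w :
  edom (objective f g h C) x -> subdiff g x y -> subdiff h2 x z ->
  accepted f g h h1 h2 C sigma x y z w ->
  edom (objective f g h C) w /\
  (objective f g h C w + (sigma / 2 * l2norm (w - x) ^+ 2)%:E
   <= objective f g h C x)%E.
Proof.
move=> /edom_objectiveP[gx Cx] gy hz [gw].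
have yD : y \in edom (conjugate g).
  by apply/mem_set; rewrite /edom /= (conjugate_subdiff _ _ _ gy) ltry.
have zD : z \in edom (conjugate h2).
  by apply/mem_set; rewrite /edom /= (conjugate_subdiff _ _ _ hz) ltry.
rewrite /Qfun yD zD /= (conjugate_subdiff _ _ _ gy) (conjugate_subdiff _ _ _ hz).
(* Outside [C] the left side is +oo, which contradicts acceptance since the objective at [x] is
   finite. *)
rewrite (objectiveE x) // /set_iota; case: ifPn => [/set_mem Cw|_] /=; last first.
  by rewrite -?EFinB -?EFinM.
rewrite /edom /= objectiveE // add0e -!EFinB -!EFinD !lee_fin => Q_le.
split; first exact: ltry.
apply: le_trans Q_le; rewrite lerD2r h_dec.
have gw0 : g w != 0 by exact: gw.
have fenchel_g := gy w; have fenchel_h := hz w.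
rewrite dotpBr !(dotpC y) in fenchel_g; rewrite dotpBr !(dotpC z) in fenchel_h.
have coef0 : 0 <= (g w)^-1 ^+ 2 * f w by rewrite mulr_ge0 // sqr_ge0.
(* This cancels at most one of the two copies of [f w / g w] in the term [2 * c * f w] of [Qfun]. *)
have : - ((g w)^-1 * f w) <= (g w)^-1 ^+ 2 * f w * (dotp x y - g x - dotp w y).
  have -> : - ((g w)^-1 * f w) = (g w)^-1 ^+ 2 * f w * - g w by field.
  by apply: ler_wpM2l => //; lra.
rewrite [f w / g w]mulrC; lra.
Qed.

End descent.

Lemma bounded_set_normr_le {R : realType} {V : normedModType R} (A : set V) (M : R) :
  (forall u, A u -> `|u| <= M) -> bounded_set A.
Proof.
move=> AM; apply: filterS (nbhs_pinfty_ge (num_real M)) => N MN u /AM uM.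
exact: le_trans uM MN.
Qed.

(* Every index k with d k > e makes u drop by more than e, while the total drop is
   at most u 0 - l. *)
Lemma telescope_pigeonhole {R : realType} (u d : nat -> R) (l e : R) :
  0 < e -> (forall k, u k.+1 + d k <= u k) -> (forall k, l <= u k) ->
  exists2 k : nat, k%:R <= (u 0%N - l) / e & d k <= e.
Proof.
move=> e0 ud ul; apply: contrapT => no_k.
(* [N] exceeds [K], yet every [k < N] is at most [K]; so [N] drops of more than [e] would take [u N]
   below [l]. *)
pose K := (u 0%N - l) / e; pose N := (Num.truncn K).+1.
have K0 : 0 <= K by rewrite divr_ge0 ?(ltW e0) // subr_ge0.
have sum_le k : (k <= N)%N -> u k + k%:R * e <= u 0%N.
  elim: k => [_|k IHk kN]; first by rewrite mul0r addr0.
  have d_gt : e < d k.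
    rewrite ltNge; apply/negP => dk; apply: no_k; exists k => //.
    have /andP[KN _] := truncn_itv K0.
    by apply: le_trans KN; rewrite ler_nat.
  by have := IHk (ltnW kN); have := ud k; rewrite -natr1; lra.
have := sum_le N (leqnn _); have := ul N.
have : K < N%:R by exact: truncnS_gt.
rewrite /K ltr_pdivrMr //; lra.
Qed.

(** * Convergence and complexity of the algorithm *)

Theorem corollary9 (R : realType) (n : nat)
    (f g h h1 h2 : 'rV[R]_n -> R) (C : set 'rV[R]_n)
    (f_ge0 : forall u, 0 <= f u) (g_ge0 : forall u, 0 <= g u)
    (f_lsc : lower_semicontinuous (EFin \o f))
    (g_lsc : lower_semicontinuous (EFin \o g))
    (h_lsc : lower_semicontinuous (EFin \o h))
    (C_closed : closed C)
    (C_Omega : C `&` Omega g !=set0)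
    (f_lip : locally_lipschitz f (Omega g))
    (g_convex : @convex_function R 'rV[R]_n setT g)
    (h_dec : forall u, h u = h1 u - h2 u)
    (h1_smooth : locally_lipschitz_differentiable h1 (Omega g))
    (h2_convex : @convex_function R 'rV[R]_n setT h2)
    (alow aup sigma gamma : R)
    (alow_gt0 : 0 < alow) (alow_le : alow <= aup)
    (sigma_gt0 : 0 < sigma) (gamma_gt0 : 0 < gamma) (gamma_lt1 : gamma < 1)
    (x y z : nat -> 'rV[R]_n) (c : nat -> R)
    (F := objective f g h C)
    (X_compact : compact [set u | edom F u /\ (F u <= F (x 0%N))%E])
    (xyzc_AMPDA : AMPDA f g h h1 h2 C alow aup sigma gamma x y z c)
    (Finf := ereal_inf (range (fun k => F (x k)))) :
  [/\ bounded_set (range (fun k => (x k, y k, z k, c k))),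
      [/\ nonincreasing_seq (fun k => F (x k)),
          Finf \is a fin_num,
          (fun k => F (x k)) @ \oo --> Finf &
          (fun k => l2norm (x k.+1 - x k)) @ \oo --> (0 : R)] &
      forall eps : R, 0 < eps ->
        exists2 khat : nat,
          (khat%:R%:E
           <= (2 / (sigma * eps ^+ 2))%:E * (F (x 0%N) - Finf))%E &
          eps_critical f g h1 h2 C eps (x khat)].
Proof.
have [x0D step] := xyzc_AMPDA.
have descent k : edom F (x k) -> edom F (x k.+1) /\
    (F (x k.+1) + (sigma / 2 * l2norm (x k.+1 - x k) ^+ 2)%:E <= F (x k))%E.
  move=> xkD; have [_ yk zk [_ [_ [_ _ _ xk_acc]]]] := step k.
  exact: (accepted_descent _ _ _ _ _ _ _ f_ge0 h_dec _ _ _ _ xkD yk zk xk_acc).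
have xD k : edom F (x k) by elim: k => // k /descent[].
(* The objective is finite along the iterates, so the estimates can be made over the reals. *)
pose u k := f (x k) / g (x k) + h (x k).
have FxE k : F (x k) = (u k)%:E.
  by have [gx Cx] := edom_objectiveP _ _ _ _ _ (xD k); exact: objectiveE.
have u_descent k : u k.+1 + sigma / 2 * l2norm (x k.+1 - x k) ^+ 2 <= u k.
  by have [_] := descent k (xD k); rewrite !FxE.
have step_ge0 k : 0 <= sigma / 2 * l2norm (x k.+1 - x k) ^+ 2.
  by rewrite mulr_ge0 ?sqr_ge0 //; lra.
have F_mono : nonincreasing_seq (fun k => F (x k)).
  apply/nonincreasing_seqP => k; rewrite !FxE lee_fin.
  by have := u_descent k; have := step_ge0 k; lra.
have xX k : edom F (x k) /\ (F (x k) <= F (x 0%N))%E.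
  by split; [exact: xD | exact: F_mono].
have [Mx xMx] : exists M, forall k, `|x k| <= M.
  have [M [_ XM]] := compact_bounded X_compact.
  by exists (M + 1) => k; apply: XM (xX k); rewrite ltrDl.
have [a a0 ag] : exists2 a, 0 < a & forall k, a < g (x k).
  (* The level set lies in [Omega g], so [g] is positive there; letting [a] tend to 0 from the right
     keeps the uniform bound positive. *)
  have gX : forall v, edom F v /\ (F v <= F (x 0%N))%E ->
      exists2 b, (b%:E < (EFin \o g) v)%E & \forall a \near (0 : R)^'+, a <= b.
    move=> v [/edom_objectiveP[gv _] _].
    have gv_gt0 : 0 < g v by rewrite lt_neqAle eq_sym gv g_ge0.
    exists (g v / 2); first by rewrite /= lte_fin; lra.
    by apply: nbhs_right_le; lra.
  have /filter_ex[a [a0 ag]] : \forall a \near (0 : R)^'+, 0 < a /\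
      forall v, edom F v /\ (F v <= F (x 0%N))%E -> (a%:E < (EFin \o g) v)%E.
    apply: filterI; first exact: nbhs_right_gt.
    exact: lower_semicontinuous_near_compact g_lsc X_compact gX.
  by exists a => // k; rewrite -lte_fin; exact: ag (xX k).
have [b bu] : exists b, forall k, b <= u k.
  (* A bound of any sign suffices for [h]; it passes to [u] because [f / g] is nonnegative. *)
  have hX : forall v, edom F v /\ (F v <= F (x 0%N))%E ->
      exists2 b, (b%:E < (EFin \o h) v)%E & \forall a \near (-oo : set_system R), a <= b.
    move=> v _; exists (h v - 1); first by rewrite /= lte_fin; lra.
    by apply: nbhs_ninfty_le; exact: num_real.
  have /filter_ex[b bh] : \forall b \near (-oo : set_system R),
      forall v, edom F v /\ (F v <= F (x 0%N))%E -> (b%:E < (EFin \o h) v)%E.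
    exact: lower_semicontinuous_near_compact h_lsc X_compact hX.
  exists b => k; have := bh _ (xX k); rewrite /= lte_fin => bhk.
  by rewrite (le_trans (ltW bhk)) // lerDr divr_ge0.
have Finf_le k : (Finf <= F (x k))%E by apply: ereal_inf_lbound; exists k.
have Finf_fin : Finf \is a fin_num.
  rewrite fin_numE; apply/andP; split.
    rewrite gt_eqF // (@lt_le_trans _ _ b%:E) ?ltNyr //.
    by apply: le_ereal_inf_tmp => _ [k _ <-]; rewrite FxE lee_fin.
  by rewrite lt_eqF // (le_lt_trans (Finf_le 0%N)) // FxE ltry.
have F_cvg : (fun k => F (x k)) @ \oo --> Finf.
  exact: ereal_nonincreasing_cvgn.
have uinf k : fine Finf <= u k by rewrite -lee_fin fineK // -FxE.
split.
- have [My yMy] := subdiff_bounded g Mx g_convex.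
  have [Mz zMz] := subdiff_bounded h2 Mx h2_convex.
  apply: (@bounded_set_normr_le _ _ _ (Num.max (Num.max (Num.max Mx My) Mz) a^-1)).
  move=> _ [k _ <-]; have [ck yk zk _] := step k.
  rewrite !prod_normE /= !ge_max !le_max xMx (yMy _ _ (xMx k) yk).
  rewrite (zMz _ _ (xMx k) zk) ck !orbT /=.
  have gk : 0 < g (x k) by exact: lt_trans a0 (ag k).
  by rewrite ger0_norm ?invr_ge0 ?(ltW gk) // lef_pV2 ?posrE // (ltW (ag k)) orbT.
- split => //.
  have u_cvg : u @ \oo --> fine Finf.
    have -> : u = fine \o (fun k => F (x k)) by apply/funext => k; rewrite /= FxE.
    by apply: fine_cvg; rewrite fineK.
  (* These gaps dominate the squared step lengths, and they vanish because [u] converges. *)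
  have gap_cvg : (fun k => 2 / sigma * (u k - u k.+1)) @ \oo --> (0 : R).
    rewrite -[X in _ --> X](mulr0 (2 / sigma)) -(subrr (fine Finf)).
    by apply: cvgMl_tmp; apply: cvgB => //; rewrite cvg_shiftS.
  have sqr_cvg : (fun k => l2norm (x k.+1 - x k) ^+ 2) @ \oo --> (0 : R).
    apply: (squeeze_cvgr _ (cvg_cst 0) gap_cvg).
    apply: nearW => k; rewrite sqr_ge0 /=.
    rewrite -(ler_pM2l (_ : 0 < sigma / 2)); last by lra.
    have -> : sigma / 2 * (2 / sigma * (u k - u k.+1)) = u k - u k.+1.
      by field; lra.
    by have := u_descent k; lra.
  rewrite -[X in _ --> X](sqrtr0 R).
  have -> : (fun k => l2norm (x k.+1 - x k)) =
      (fun k => Num.sqrt (l2norm (x k.+1 - x k) ^+ 2)).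
    by apply/funext => k; rewrite sqrtr_sqr ger0_norm // sqrtr_ge0.
  by apply: continuous_cvg => //; exact: sqrt_continuous.
- move=> eps eps0.
  (* With this threshold a small decrease means a step of length at most [eps], and the pigeonhole
     bound becomes the required [K]. *)
  have e0 : 0 < sigma / 2 * eps ^+ 2 by rewrite mulr_gt0 ?exprn_gt0 //; lra.
  have [k kK dk] := telescope_pigeonhole u _ (fine Finf) _ e0 u_descent uinf.
  exists k.
    rewrite -(fineK Finf_fin) FxE -EFinB -EFinM lee_fin (le_trans kK) //.
    suff -> : (u 0%N - fine Finf) / (sigma / 2 * eps ^+ 2) =
        2 / (sigma * eps ^+ 2) * (u 0%N - fine Finf) by [].
    by field; rewrite !lt0r_neq0.
  have [ck yk zk [alpha [j [/andP[alpha_ge _] _ xk1 _]]]] := step k.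
  split; first by have [] := edom_objectiveP _ _ _ _ _ (xD k).
  (* The witness is the accepted step size, whose proximal set contains [x k.+1]. *)
  exists (alpha * gamma ^+ j), (y k), (z k); split => //.
    by rewrite mulr_gt0 ?exprn_gt0 // (lt_le_trans alow_gt0).
  rewrite -ck; apply: le_trans (ereal_inf_lbound _) _; first by exists (x k.+1).
  rewrite lee_fin l2normB -(ler_pXn2r (ltn0Sn 1)) ?nnegrE ?sqrtr_ge0 ?(ltW eps0) //.
  by rewrite -(ler_pM2l (_ : 0 < sigma / 2)) //; lra.
Qed.
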